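(* Let $\mathcal P_c(\mathbb R^n)$ denote the collection of non-empty compact subsets of $(\mathbb R^n,\|\cdot\|_1)$, equipped with the Hausdorff metric $\Delta$ induced by $\|\cdot\|_1$. For $d\in\mathbb R_{++}^n$ and $P\subseteq\mathbb R^n$ let $M_d(P):=\bigcup_{y\in P}\{x\in\mathbb R^n\,|\,x\prec_d y\}$. Then: (i) for all $d\in\mathbb R_{++}^n$ and all $P,P'\in\mathcal P_c(\mathbb R^n)$, $\Delta(M_d(P),M_d(P'))\leq \Delta(P,P')$; (ii) the map $\mathbb R_{++}^n\times(\mathcal P_c(\mathbb R^n),\Delta)\to(\mathcal P_c(\mathbb R^n),\Delta)$, $(d,P)\mapsto M_d(P)$, is continuous (with respect to the product topology, $\mathbb R_{++}^n$ carrying the topology of $\|\cdot\|_1$).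
   Context: A matrix $A\in\mathbb R^{n\times n}$ is $d$-stochastic if all its entries are nonnegative, $\mathbf 1^TA=\mathbf 1^T$ ($\mathbf 1$ the all-ones vector) and $Ad=d$; $x\prec_d y$ means $x=Ay$ for some $d$-stochastic $A$. The Hausdorff distance of nonempty compact $A,B$ is $\Delta(A,B)=\max\{\max_{z\in A}\min_{w\in B}\|z-w\|_1,\max_{z\in B}\min_{w\in A}\|z-w\|_1\}$. *)

(* Defs.v *)
From HB Require Import structures.
From mathcomp Require Import all_boot all_order all_algebra.
From mathcomp Require Import all_classical all_reals all_analysis.

Set Implicit Arguments.
Unset Strict Implicit.
Unset Printing Implicit Defensive.

Import Order.TTheory GRing.Theory Num.Theory.
Import numFieldNormedType.Exports.

Local Open Scope classical_set_scope.
Local Open Scope ring_scope.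

(* (R^n, ||.||_1). It is an alias of 'cV[R]_n because the library already puts
   the maximum norm on 'cV[R]_n: norm, topology and compactness on l1 R n are
   those induced by norm1. *)
Definition l1 (R : realType) (n : nat) : Type := 'cV[R]_n.

HB.instance Definition _ (R : realType) (n : nat) :=
  GRing.Lmodule.copy (l1 R n) 'cV[R]_n.

Section norm1.
Variables (R : realType) (n : nat).
Implicit Types x y : l1 R n.

Definition norm1 x : R := \sum_(i < n) `|x i ord0|.

Lemma norm1_triangle x y : norm1 (x + y) <= norm1 x + norm1 y.
Proof.
by rewrite /norm1 -big_split; apply: ler_sum => i _; rewrite mxE ler_normD.
Qed.

Lemma norm1Z (a : R) x : norm1 (a *: x) = `|a| * norm1 x.
Proof.
by rewrite /norm1 mulr_sumr; apply: eq_bigr => i _; rewrite mxE normrM.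
Qed.

Lemma norm1_eq0 x : norm1 x = 0 -> x = 0.
Proof.
move=> /eqP; rewrite psumr_eq0 => [/allP x0|i _]; last exact: normr_ge0.
apply/colP => i; rewrite mxE; apply/eqP; rewrite -normr_eq0.
exact: (x0 i (mem_index_enum i)).
Qed.

HB.instance Definition _ :=
  Lmodule_isNormed.Build R (l1 R n) norm1_triangle norm1Z norm1_eq0.

End norm1.

Section hausdorff_distance.
Variables (R : realType) (V : normedModType R).
Implicit Types (A B : set V) (z w : V).

Definition dist_to B z : R := inf [set `|z - w| | w in B].

Definition excess A B : R := sup [set dist_to B z | z in A].

(* The suprema and infima are attained on nonempty compact sets
   (dist_to_min and excess_max below). *)
Definition hausdorff_dist A B : R := Num.max (excess A B) (excess B A).

Lemma dist_to_le B z w : B w -> dist_to B z <= `|z - w|.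
Proof. by move=> Bw; apply: ge_inf; [exists 0 => _ [? _ <-] | exists w]. Qed.

Lemma dist_to_min B z : compact B -> B !=set0 ->
  exists2 w, B w & dist_to B z = `|z - w|.
Proof.
move=> cB B0.
have [|w /set_mem Bw wmin] := @compact_EVT_min V R (fun w => `|z - w|) B B0 cB.
  apply: continuous_subspaceT => w; apply: cvg_norm.
  by apply: cvgB; [exact: cvg_cst|exact: cvg_id].
exists w => //; apply/eqP; rewrite eq_le dist_to_le//=.
apply: lb_le_inf; first by exists `|z - w|, w.
by move=> _ [v Bv <-]; apply: wmin; exact: mem_set.
Qed.

Lemma dist_to_lipschitz B z z' : compact B -> B !=set0 ->
  dist_to B z - dist_to B z' <= `|z - z'|.
Proof.
move=> cB B0; have [w Bw ->] := dist_to_min z' cB B0.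
by rewrite lerBlDr (le_trans (dist_to_le z Bw))// ler_distD.
Qed.

Lemma dist_to_continuous B : compact B -> B !=set0 -> continuous (dist_to B).
Proof.
move=> cB B0 z; apply/cvgrPdist_lt => e e0.
near=> z'; apply: (@le_lt_trans _ _ `|z - z'|); last first.
  by near: z'; exact: cvgr_dist_lt.
rewrite ler_norml dist_to_lipschitz// lerNl opprB (distrC z) andbT.
exact: dist_to_lipschitz.
Unshelve. all: by end_near. Qed.

Lemma excess_max A B : compact A -> A !=set0 -> compact B -> B !=set0 ->
  exists2 z, A z & excess A B = dist_to B z /\
    forall z', A z' -> dist_to B z' <= dist_to B z.
Proof.
move=> cA A0 cB B0.
have [|z /set_mem Az zmax] := @compact_EVT_max V R (dist_to B) A A0 cA.
  exact/continuous_subspaceT/dist_to_continuous.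
have {}zmax z' : A z' -> dist_to B z' <= dist_to B z.
  by move=> Az'; exact/zmax/mem_set.
exists z => //; split=> //; apply/eqP; rewrite eq_le; apply/andP; split.
  by apply: ge_sup => [|_ [z' Az' <-]]; [exists (dist_to B z), z|exact: zmax].
by apply: ub_le_sup; [exists (dist_to B z) => _ [z' Az' <-]; exact: zmax|exists z].
Qed.

Lemma excess_leP A B (r : R) :
    compact A -> A !=set0 -> compact B -> B !=set0 ->
  excess A B <= r <-> forall z, A z -> exists2 w, B w & `|z - w| <= r.
Proof.
move=> cA A0 cB B0; have [z Az [-> zmax]] := excess_max cA A0 cB B0; split.
  move=> zr y Ay; have [w Bw wE] := dist_to_min y cB B0; exists w => //.
  by rewrite -wE (le_trans (zmax _ Ay)).
by move=> /(_ z Az)[w Bw]; apply/le_trans/dist_to_le.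
Qed.

End hausdorff_distance.

Record compacts (R : realType) (V : normedModType R) := Compacts {
  carrier :> set V;
  compacts_compact : compact carrier;
  compacts_nonempty : carrier !=set0 }.

Section compacts_metric.
Variables (R : realType) (V : normedModType R).
Implicit Types A B C : compacts V.

HB.instance Definition _ := gen_eqMixin (compacts V).
HB.instance Definition _ := gen_choiceMixin (compacts V).

Lemma compacts_eq A B : carrier A = carrier B -> A = B.
Proof.
case: A B => [A cA A0] [B cB B0] /= AB; rewrite -{}AB in cB B0 *.
by congr Compacts; exact: Prop_irrelevance.
Qed.

Lemma compacts_excess_leP A B (r : R) :
  excess A B <= r <->
    forall z, carrier A z -> exists2 w, carrier B w & `|z - w| <= r.
Proof.
by case: A B => [A cA A0] [B cB B0] /=; exact: excess_leP.
Qed.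

Lemma excessxx A : excess A A <= 0.
Proof.
by apply/compacts_excess_leP => z Az; exists z; rewrite ?subrr ?normr0.
Qed.

Lemma excess_ge0 A B : 0 <= excess A B.
Proof.
have [z Az] := compacts_nonempty A.
have /compacts_excess_leP/(_ z Az)[w _] := lexx (excess A B).
exact/le_trans/normr_ge0.
Qed.

Lemma excess_triangle B A C : excess A C <= excess A B + excess B C.
Proof.
apply/compacts_excess_leP => z Az.
have /compacts_excess_leP/(_ z Az)[w Bw zw] := lexx (excess A B).
have /compacts_excess_leP/(_ w Bw)[v Cv wv] := lexx (excess B C).
by exists v => //; rewrite (le_trans (ler_distD w _ _))// lerD.
Qed.

Lemma excess_subset A B : excess A B <= 0 -> carrier A `<=` carrier B.
Proof.
move=> /compacts_excess_leP AB z /AB[w Bw].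
by rewrite normr_le0 subr_eq0 => /eqP ->.
Qed.

Lemma hausdorff_distxx A : hausdorff_dist A A = 0.
Proof.
by rewrite /hausdorff_dist maxxx; apply/eqP; rewrite eq_le excessxx excess_ge0.
Qed.

Lemma hausdorff_dist_eq0 A B : hausdorff_dist A B = 0 -> A = B.
Proof.
move=> AB0; have : hausdorff_dist A B <= 0 by rewrite AB0.
rewrite ge_max => /andP[AB BA].
by apply/compacts_eq/seteqP; split; exact: excess_subset.
Qed.

Lemma hausdorff_distC A B : hausdorff_dist A B = hausdorff_dist B A.
Proof. by rewrite /hausdorff_dist maxC. Qed.

Lemma hausdorff_dist_triangle B A C :
  hausdorff_dist A C <= hausdorff_dist A B + hausdorff_dist B C.
Proof.
rewrite ge_max (le_trans (excess_triangle B _ _))/=; last first.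
  by rewrite lerD// le_max lexx.
by rewrite (le_trans (excess_triangle B _ _))// addrC lerD// le_max lexx orbT.
Qed.

HB.instance Definition _ := isMetric.Build R (compacts V)
  hausdorff_distxx hausdorff_dist_eq0 hausdorff_distC hausdorff_dist_triangle.

End compacts_metric.

Section d_majorization.
Variables (R : realType) (n : nat).
Implicit Types (d x y : l1 R n) (P : set (l1 R n)).

Definition d_stochastic d (A : 'M[R]_n) : Prop :=
  [/\ forall i j, 0 <= A i j,
      (const_mx 1 : 'rV[R]_n) *m A = const_mx 1
    & A *m d = d].

Definition d_majorized d x y : Prop :=
  exists2 A : 'M[R]_n, d_stochastic d A & x = A *m y.

Definition M d P : set (l1 R n) :=
  \bigcup_(y in P) [set x | d_majorized d x y].

Definition posvec : set (l1 R n) := [set d | forall i, 0 < d i ord0].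

End d_majorization.

Arguments posvec : clear implicits.

(* Main.v *)
(* A [d]-stochastic matrix does not increase the 1-norm, so applying to a point
   of [P'] near [y] the matrix that sends [y] to [x] gives (i).  For the
   dependence on [d], let [0 <= lam <= 1] satisfy [lam d <= d'] and
   [lam d' <= d] entrywise and put [D = diag(lam d_j / d'_j)]: if [A] is
   [d]-stochastic then [A D + (1 - D)] is [d']-stochastic, and its value at [y]
   is within [2 (1 - lam^2) ||y||_1] of [A y].  Hence [M_d P] and [M_d' P] are
   uniformly close for bounded [P] when [d'] tends to [d], since [lam] can be
   taken close to [1]; joint continuity follows from (i) and the triangle
   inequality. *)
Require Import Defs.
From mathcomp Require Import all_boot all_order all_algebra.
From mathcomp Require Import all_classical all_reals all_analysis.
From mathcomp Require Import lra.
Import Order.TTheory GRing.Theory Num.Theory.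
Import numFieldNormedType.Exports.
Local Open Scope classical_set_scope.
Local Open Scope ring_scope.

(** * Coordinates and the topology of the 1-norm *)

Section l1_space.
Context {R : realType} {n : nat}.
Implicit Types (x y : l1 R n).

Lemma l1_normE x : `|x| = \sum_(i < n) `|x i ord0|.
Proof. by []. Qed.

Lemma l1_cvg {T : Type} {F : set_system T} {FF : Filter F} (f : T -> l1 R n) y :
  (forall i, f t i ord0 @[t --> F] --> y i ord0) -> f @ F --> y.
Proof.
move=> fy; apply/cvgrPdist_lt => e e0.
(* Dividing by [n.+1] covers [n = 0] and keeps the sum of [n] terms strictly below [e]. *)
have en : 0 < e / n.+1%:R by rewrite divr_gt0.
have : \forall t \near F, forall i, `|y i ord0 - f t i ord0| < e / n.+1%:R.
  by apply: filter_forall => i; exact: cvgr_dist_lt.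
apply: filterS => t yf; rewrite l1_normE.
apply: (@le_lt_trans _ _ (\sum_(i < n) e / n.+1%:R)).
  by apply: ler_sum => i _; rewrite !mxE ltW.
rewrite sumr_const card_ord -[ltLHS]mulr_natr -mulrA gtr_pMr//.
by rewrite mulrC ltr_pdivrMr// mul1r ltr_nat.
Qed.

Lemma l1_coord_continuous i : continuous (fun x => x i ord0).
Proof.
move=> x; have FF : Filter (nbhs x) := nbhs_filter x.
apply/cvgrPdist_lt => e e0.
have : \forall y \near nbhs x, `|x - y| < e.
  by apply: cvgr_dist_lt => //; exact: cvg_id.
apply: filterS => y; apply: le_lt_trans.
rewrite l1_normE (bigD1 i)//= !mxE lerDl.
by apply: sumr_ge0 => j _; exact: normr_ge0.
Qed.

End l1_space.

(** * Stochastic matrices and the change of the fixed vector *)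

Section stochastic.
Context {R : realType} {n : nat}.
Implicit Types (d x y : l1 R n) (A : 'M[R]_n).

Lemma col_sum_mulmxP A : (const_mx 1 : 'rV[R]_n) *m A = const_mx 1 <->
  forall j, \sum_i A i j = 1.
Proof.
have E j : ((const_mx 1 : 'rV[R]_n) *m A) ord0 j = \sum_i A i j.
  by rewrite mxE; apply: eq_bigr => i _; rewrite mxE mul1r.
split=> [A1 j|A1]; first by rewrite -E A1 mxE.
by apply/rowP => j; rewrite E A1 mxE.
Qed.

Lemma d_stochastic1 d : d_stochastic d 1%:M.
Proof.
split; [|exact: mulmx1|exact: mul1mx].
by move=> i j; rewrite mxE ler0n.
Qed.

(** Triangle inequality in each row, then exchange of the two sums: each [|y_j|] gets the sum of
    column [j] as its weight, which is 1. *)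
Lemma d_stochastic_norm_le {d A} y : d_stochastic d A ->
  `|A *m y : l1 R n| <= `|y|.
Proof.
move=> [A0 /col_sum_mulmxP A1 _]; rewrite !l1_normE.
apply: (@le_trans _ _ (\sum_i \sum_j A i j * `|y j ord0|)).
  apply: ler_sum => i _; rewrite mxE (le_trans (ler_norm_sum _ _ _))//.
  by apply: ler_sum => j _; rewrite normrM ger0_norm.
rewrite exchange_big/=; apply: ler_sum => j _.
by rewrite -mulr_suml A1 mul1r.
Qed.

Lemma d_majorizedxx d y : d_majorized d y y.
Proof. by exists 1%:M; [exact: d_stochastic1|rewrite mul1mx]. Qed.

(** Closeness is multiplicative and symmetric, so that one [lam] bounds both excesses in the
    Hausdorff distance. *)
Definition within_ratio (lam : R) d d' : Prop :=
  forall i, lam * d i ord0 <= d' i ord0 /\ lam * d' i ord0 <= d i ord0.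

Lemma within_ratioC lam d d' : within_ratio lam d d' -> within_ratio lam d' d.
Proof. by move=> dd' i; have [] := dd' i. Qed.

(* If [A] fixes [d], then [A *m D] sends [d'] to [lam *: d] because
   [D *m d' = lam *: d]; adding [1 - D >= 0] on the diagonal makes [d'] fixed
   while keeping the column sums equal to one. *)
Lemma d_majorized_perturb {d d' x y} {lam : R} :
    posvec R n d' -> 0 <= lam -> within_ratio lam d d' ->
  d_majorized d x y ->
  exists2 x', d_majorized d' x' y & `|x - x'| <= 2 * (1 - lam ^+ 2) * `|y|.
Proof.
move=> d'0 lam0 dd'r [A stA ->{x}].
have [A0 A1 Ad] := stA.
have dd' i := (dd'r i).1; have d'd i := (dd'r i).2.
pose r : 'rV[R]_n := \row_j (lam * d j ord0 / d' j ord0).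
(* The inequality [lam d' <= d] bounds [r] below by [lam ^+ 2]; [lam d <= d'] bounds it above by
   1. *)
have r_ge j : lam ^+ 2 <= r ord0 j.
  by rewrite mxE ler_pdivlMr ?d'0// expr2 -mulrA ler_wpM2l.
have r_le1 j : r ord0 j <= 1 by rewrite mxE ler_pdivrMr ?d'0// mul1r.
have r_ge0 j : 0 <= r ord0 j by rewrite (le_trans (sqr_ge0 lam)).
have rd : diag_mx r *m (d' : 'cV_n) = lam *: (d : 'cV_n).
  apply/colP => i; rewrite mul_diag_mx !mxE divfK//.
  by rewrite gt_eqF ?d'0.
pose A' : 'M[R]_n := A *m diag_mx r + (1%:M - diag_mx r).
have stA' : d_stochastic d' A'.
  split.
  - move=> i j; rewrite /A' mul_mx_diag !mxE; apply: addr_ge0.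
      by apply: mulr_ge0 => //; have := r_ge0 j; rewrite mxE.
    have [_|_] := eqVneq i j; last by rewrite !mulr0n subr0.
    by have := r_le1 i; rewrite mxE !mulr1n subr_ge0.
  - by rewrite mulmxDr mulmxA A1 mulmxBr mulmx1 addrC subrK.
  - by rewrite mulmxDl -mulmxA rd -scalemxAr Ad mulmxBl mul1mx rd addrC subrK.
(* The error [A y - A' y] equals [A z - z], and [A] does not increase the norm of [z]: hence the
   factor 2. *)
pose z : l1 R n := (1%:M - diag_mx r) *m (y : 'cV_n).
exists (A' *m y); first by exists A'.
have -> : (A *m y : l1 R n) - (A' *m y : l1 R n) = (A *m z : l1 R n) - z.
  rewrite /A' /z -mulmxBl mulmxA -mulmxBl; congr (_ *m _).
  by rewrite mulmxBr mulmx1 opprD addrA.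
have zy : `|z| <= (1 - lam ^+ 2) * `|y|.
  rewrite !l1_normE mulr_sumr; apply: ler_sum => i _.
  rewrite /z mulmxBl mul1mx mul_diag_mx !mxE -[X in X - _]mul1r -mulrBl normrM.
  have := r_ge i; have := r_le1 i; rewrite mxE => ri1 ri.
  by rewrite ler_wpM2r// ger0_norm ?subr_ge0// lerD2l lerN2.
rewrite (le_trans (ler_normB _ _))// -mulrA mulr_natl mulr2n.
by rewrite lerD// (le_trans (d_stochastic_norm_le _ stA)).
Qed.

(** * Compactness of [M d P] *)

Let stochastic_vec d : set 'rV[R]_(n * n) :=
  [set v | d_stochastic d (vec_mx v)].

(** Matrices are flattened to row vectors so that compactness of a product of segments applies.
    Nonnegative entries in columns of sum 1 lie in [[0, 1]], and the linear equations cut a closed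
    subset out of this cube. *)
Lemma stochastic_vec_compact d : compact (stochastic_vec d).
Proof.
have cf i j : continuous (fun v : 'rV[R]_(n * n) => vec_mx v i j).
  rewrite [X in continuous X](_ : _ =
      fun v : 'rV[R]_(n * n) => v ord0 (mxvec_index i j)).
    exact: coord_continuous.
  by apply/funext => v; rewrite mxE.
pose box := [set v : 'rV[R]_(n * n) | forall k, `[0, 1]%classic (v ord0 k)].
pose cols := \bigcap_(j in [set: 'I_n])
  [set v : 'rV[R]_(n * n) | \sum_i vec_mx v i j = 1].
pose fixd := \bigcap_(i in [set: 'I_n])
  [set v : 'rV[R]_(n * n) | \sum_j vec_mx v i j * d j ord0 = d i ord0].
rewrite (_ : stochastic_vec d = box `&` (cols `&` fixd)).
  apply: compact_closedI.
    apply: (@rV_compact R _ (fun=> `[0, 1]%classic)) => k.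
    exact: segment_compact.
  have closed_fiber (g : 'rV[R]_(n * n) -> R) a :
      continuous g -> closed [set v | g v = a].
    move=> cg; apply: (@preimage_closed _ _ g [set x | x = a]).
      by move=> v _; exact: cg.
    exact: closed_eq.
  apply: closedI; apply: closed_bigI => i _; apply: closed_fiber.
    by apply: continuous_big => [|k _]; [exact: add_continuous|exact: cf].
  apply: continuous_big => [|k _]; first exact: add_continuous.
  by move=> v; exact: (cvgM (cf i k v) (cvg_cst _)).
apply/seteqP; split=> v.
  move=> [v0 /col_sum_mulmxP v1 vd]; split; last split.
  - move=> k; case/mxvec_indexP: k => i j.
    have := v0 i j; have := v1 j; rewrite (bigD1 i)//= => v1' v0'.
    have {v1'} : vec_mx v i j <= 1 by rewrite -v1' lerDl sumr_ge0.
    by move: v0'; rewrite mxE /= in_itv/= => -> ->.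
  - by move=> j _; exact: v1.
  - by move=> i _ /=; rewrite -[in RHS]vd mxE.
move=> [vbox [v1 vd]]; split.
- move=> i j; rewrite mxE; have := vbox (mxvec_index i j).
  by rewrite /= in_itv/= => /andP[].
- by apply/col_sum_mulmxP => j; exact: v1.
- by apply/colP => i; rewrite mxE; exact: vd.
Qed.

(** [M d P] is the image of a compact product under the continuous map [(A, y) |-> A y]. *)
Lemma M_compact d {P : set (l1 R n)} : compact P -> compact (M d P).
Proof.
move=> cP.
pose f (u : 'rV[R]_(n * n) * l1 R n) : l1 R n := vec_mx u.1 *m (u.2 : 'cV_n).
rewrite (_ : M d P = f @` (stochastic_vec d `*` P)).
  apply: continuous_compact; last first.
    by apply: compact_setX => //; exact: stochastic_vec_compact.
  apply: continuous_subspaceT => u; apply: l1_cvg => i.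
  rewrite [X in X @ _](_ : _ =
      fun t : 'rV[R]_(n * n) * l1 R n =>
        \sum_j t.1 ord0 (mxvec_index i j) * t.2 j ord0); last first.
    by apply/funext => t; rewrite mxE; apply: eq_bigr => j _; rewrite mxE.
  rewrite [X in _ --> X](_ : _ =
      \sum_j u.1 ord0 (mxvec_index i j) * u.2 j ord0); last first.
    by rewrite mxE; apply: eq_bigr => j _; rewrite mxE.
  apply: cvg_big => [|j _]; first exact: add_continuous.
  pose k := mxvec_index i j.
  have c1 : (fun t : 'rV[R]_(n * n) * l1 R n => t.1 ord0 k) @ u --> u.1 ord0 k.
    apply: (@cvg_comp _ _ _ fst (fun v : 'rV[R]_(n * n) => v ord0 k)
              (nbhs u) (nbhs u.1)); first exact: cvg_fst.
    exact: coord_continuous.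
  have c2 : (fun t : 'rV[R]_(n * n) * l1 R n => t.2 j ord0) @ u --> u.2 j ord0.
    apply: (@cvg_comp _ _ _ snd (fun v : l1 R n => v j ord0)
              (nbhs u) (nbhs u.2)); first exact: cvg_snd.
    exact: l1_coord_continuous.
  exact: (cvgM c1 c2).
apply/seteqP; split=> [x [y Py [A stA ->]]|_ [[v y] [/= stv Py] <-]].
  by exists (mxvec A, y); rewrite /f /stochastic_vec /= ?mxvecK.
by exists y => //; exists (vec_mx v).
Qed.

Lemma M_nonempty d {P : set (l1 R n)} : P !=set0 -> M d P !=set0.
Proof. by move=> [y Py]; exists y, y => //; exact: d_majorizedxx. Qed.

(** * Estimates for the Hausdorff distance and joint continuity *)

Definition Mc d (P : compacts (l1 R n)) : compacts (l1 R n) :=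
  Compacts (M_compact d (@compacts_compact _ _ P))
    (M_nonempty d (compacts_nonempty P)).

Lemma excess_M d (P P' : compacts (l1 R n)) :
  excess (Mc d P) (Mc d P') <= excess P P'.
Proof.
apply/compacts_excess_leP => _ [y Py [A stA ->]].
have /compacts_excess_leP/(_ y Py)[w P'w yw] := lexx (excess P P').
exists (A *m w); first by exists w => //; exists A.
rewrite (le_trans _ yw)// -mulmxBr.
exact: d_stochastic_norm_le stA.
Qed.

Lemma hausdorff_dist_M d (P P' : compacts (l1 R n)) :
  hausdorff_dist (Mc d P) (Mc d P') <= hausdorff_dist P P'.
Proof. by rewrite ge_max !le_max !excess_M orbT. Qed.

Lemma excess_M_perturb d d' (P : compacts (l1 R n)) (lam B : R) :
    posvec R n d' -> 0 <= lam <= 1 ->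
    within_ratio lam d d' ->
    (forall y, carrier P y -> `|y| <= B) ->
  excess (Mc d P) (Mc d' P) <= 2 * (1 - lam ^+ 2) * B.
Proof.
move=> d'0 /andP[lam0 lam1] dd' PB.
apply/compacts_excess_leP => x [y Py xy].
have [x' x'y xx'] := d_majorized_perturb d'0 lam0 dd' xy.
exists x'; first by exists y.
by rewrite (le_trans xx')// ler_wpM2l ?PB// mulr_ge0// subr_ge0 exprn_ile1.
Qed.

Lemma hausdorff_dist_M_perturb d d' (P : compacts (l1 R n)) (lam B : R) :
    posvec R n d -> posvec R n d' -> 0 <= lam <= 1 ->
    within_ratio lam d d' ->
    (forall y, carrier P y -> `|y| <= B) ->
  hausdorff_dist (Mc d P) (Mc d' P) <= 2 * (1 - lam ^+ 2) * B.
Proof.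
move=> d0 d'0 lam01 dd' PB.
by rewrite ge_max !excess_M_perturb//; exact: within_ratioC.
Qed.

(** At [d' = d] all the inequalities are strict, because [lam < 1] and [d] is positive; being
    finitely many, they persist nearby. *)
Lemma nbhs_within_ratio {d} {lam : R} : posvec R n d -> 0 <= lam < 1 ->
  nbhs d (within_ratio lam d).
Proof.
move=> d0 /andP[lam0 lam1].
have FF : Filter (nbhs d) := nbhs_filter d.
have coord i : (fun d' : l1 R n => d' i ord0) @ d --> d i ord0.
  exact: l1_coord_continuous.
have lower : nbhs d [set d' | forall i, lam * d i ord0 < d' i ord0].
  apply: (@filter_forall _ _
    (fun i (d' : l1 R n) => lam * d i ord0 < d' i ord0) _ FF) => i.
  apply: (cvgr_gt (d i ord0) (coord i)).
  by rewrite gtr_pMl ?d0.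
have upper : nbhs d [set d' | forall i, lam * d' i ord0 < d i ord0].
  apply: (@filter_forall _ _
    (fun i (d' : l1 R n) => lam * d' i ord0 < d i ord0) _ FF) => i.
  apply: (cvgr_lt (lam * d i ord0)).
    exact: (cvgM (cvg_cst lam) (coord i)).
  by rewrite gtr_pMl ?d0.
by apply: filterS2 lower upper => d' dd' d'd i; split; exact: ltW.
Qed.

Lemma compacts_norm_bounded (P : compacts (l1 R n)) :
  exists2 B : R, 0 < B & forall y, carrier P y -> `|y| <= B.
Proof.
have [B [Breal PB]] := compact_bounded (@compacts_compact _ _ P).
(* Boundedness only provides bounds strictly above [B]; this one is also positive. *)
exists (`|B| + 1) => [|y Py]; first by rewrite ltr_wpDl.
by apply: (PB (`|B| + 1)) => //; rewrite (le_lt_trans (ler_norm B))// ltrDl.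
Qed.

Lemma Mc_continuous :
  continuous (fun u : posvec R n * compacts (l1 R n) => Mc (set_val u.1) u.2).
Proof.
move=> [d P]; apply/metricType_numDomainType.cvgrPdist_lt => e e0.
have [B B0 PB] := compacts_norm_bounded P.
have [lam /andP[lam0 lam1] lame] :
    exists2 lam : R, 0 <= lam < 1 & 2 * (1 - lam ^+ 2) * B < e / 2.
  (* With [lam = 1 - eta], [1 - lam ^+ 2 <= 2 eta], so the target is at most [4 eta B]; the choice
     of [eta] gives [8 eta B = e - eta e < e]. *)
  have eB : 0 < e + 8 * B by rewrite addr_gt0 ?mulr_gt0.
  pose eta := e / (e + 8 * B).
  have etaE : eta * (e + 8 * B) = e by rewrite /eta divfK// gt_eqF.
  have eta0 : 0 < eta by rewrite divr_gt0.
  have eta1 : eta < 1 by rewrite ltr_pdivrMr// mul1r ltrDl mulr_gt0.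
  by exists (1 - eta); nra.
have dpos (c : posvec R n) : posvec R n (set_val c) by exact: set_valP.
have near_d : nbhs d [set c | within_ratio lam (set_val d) (set_val c)].
  (* The topology of [posvec] is the one pulled back along [set_val]. *)
  apply: (@initial_continuous (posvec R n) (l1 R n) set_val d).
  by apply: nbhs_within_ratio; rewrite ?lam0.
have near_P : nbhs P [set Q | hausdorff_dist P Q < e / 2].
  apply/nbhs_ballP; exists (e / 2); first by rewrite /= divr_gt0.
  by rewrite ballEmdist.
near=> u.
have du : within_ratio lam (set_val d) (set_val u.1).
  by near: u; exact: (cvg_fst near_d).
have PQ : hausdorff_dist P u.2 < e / 2 by near: u; exact: (cvg_snd near_P).
(* Passing through [M_d' P] changes [d] only over the fixed set [P], where the bound [B] holds; the
   second distance is controlled uniformly in [d']. *)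
apply: (@le_lt_trans _ _
  (hausdorff_dist (Mc (set_val d) P) (Mc (set_val u.1) P) +
   hausdorff_dist (Mc (set_val u.1) P) (Mc (set_val u.1) u.2))).
  exact: hausdorff_dist_triangle.
rewrite (splitr e) ltrD//; last exact: le_lt_trans (hausdorff_dist_M _ _ _) PQ.
apply: le_lt_trans lame.
by apply: hausdorff_dist_M_perturb; rewrite ?lam0 ?ltW.
Unshelve. all: by end_near. Qed.

End stochastic.

Theorem theorem4p12 (R : realType) (n : nat) :
  (forall (d : l1 R n) (P P' : compacts (l1 R n)), posvec R n d ->
     hausdorff_dist (M d P) (M d P') <= hausdorff_dist P P') /\
  (exists f : posvec R n * compacts (l1 R n) -> compacts (l1 R n),
     (forall (d : posvec R n) (P : compacts (l1 R n)),
        f (d, P) = M (set_val d) P :> set (l1 R n)) /\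
     continuous f).
Proof.
split=> [d P P' _|]; first exact: (hausdorff_dist_M d P P').
exists (fun u => Mc (set_val u.1) u.2); split=> //; exact: Mc_continuous.
Qed.
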